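(* Let $(X_t)_{t>0}$ be a separable square-integrable real stochastic process with $\mathbb{E}(X_t)=0$ and $\mathbb{E}(X_tX_s)=\min\{t,s\}$ for all $s,t>0$. Let $\eta,\theta\in\mathbb{R}$ and $\sigma,\tau\ge0$, and suppose that for all $0<s<t<u$ $$\mathbb{E}[X_t\mid\mathcal F_{\ge u}]=\frac tu X_u,\qquad \mathbb{E}[X_t\mid\mathcal F_{\le s}]=X_s,$$ $$\mathrm{Var}[X_t\mid\mathcal F_{\le s}]=\frac{t-s}{1+\sigma s}\left(\sigma X_s^2+\eta X_s+1\right),$$ $$\mathrm{Var}[X_t\mid\mathcal F_{\ge u}]=\frac{t(u-t)}{u+\tau}\left(\tau\frac{X_u^2}{u^2}+\theta\frac{X_u}{u}+1\right).$$ If $\sigma\tau\le 1/2^{4r+10}$ for some $r>2$, then $\mathbb{E}(|X_t|^r)<\infty$ for all $t>0$. In particular, if $\sigma\tau=0$, then $\mathbb{E}(|X_t|^r)<\infty$ for all $r,t>0$.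
   Context: $\mathcal F_{\le s}=\sigma\{X_t:0<t\le s\}$ and $\mathcal F_{\ge u}=\sigma\{X_t:t\ge u\}$. The conditional variance is $\mathrm{Var}[X\mid\mathcal F]=\mathbb{E}[X^2\mid\mathcal F]-(\mathbb{E}[X\mid\mathcal F])^2$. Equalities between conditional expectations hold almost surely. *)

(* Defs.v *)
From HB Require Import structures.
From mathcomp Require Import all_boot all_order all_algebra.
From mathcomp Require Import all_classical all_reals all_analysis.

Set Implicit Arguments.
Unset Strict Implicit.
Unset Printing Implicit Defensive.

Import Order.TTheory GRing.Theory Num.Theory.
Import numFieldNormedType.Exports.

Local Open Scope classical_set_scope.
Local Open Scope ring_scope.

Section process.
Context {d : measure_display} {T : measurableType d} {R : realType}.

(* A process (X_t)_{t > 0} is a function X : R -> T -> R of which only the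
   values at t > 0 are ever used. *)

Definition process_sigma (X : R -> T -> R) (I : set R) : set (set T) :=
  <<s \bigcup_(t in I) preimage_set_system setT (X t) measurable >>.

Definition sigma_le (X : R -> T -> R) (s : R) : set (set T) :=
  process_sigma X [set t | 0 < t <= s].

Definition sigma_ge (X : R -> T -> R) (u : R) : set (set T) :=
  process_sigma X [set t | u <= t].

(* Separability in the sense of Doob: up to a null set, the restriction of a
   trajectory to a countable dense set D of times determines which closed
   conditions the trajectory satisfies on open intervals. *)
Definition separable_process (P : probability T R) (X : R -> T -> R) : Prop :=
  exists D : set R, exists N : set T,
    [/\ countable D, D `<=` [set t | 0 < t], [set t | 0 < t] `<=` closure D,
        P.-negligible N &
        forall (a b : R) (F : set R), closed F ->
          [set w | forall t, D t -> a < t < b -> F (X t w)] `\`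
          [set w | forall t, 0 < t -> a < t < b -> F (X t w)] `<=` N].

(* The set of all versions of E[Z | G], for an integrable Z. *)
Definition cond_exp (P : probability T R) (G : set (set T)) (Z : T -> R)
    : set (T -> R) :=
  [set Y | [/\ preimage_set_system setT Y measurable `<=` G,
               P.-integrable setT (EFin \o Y) &
               forall A, G A ->
                 (\int[P]_(w in A) (Y w)%:E = \int[P]_(w in A) (Z w)%:E)%E]].

(* The set of all versions of E[Z^2 | G] - (E[Z | G])^2. *)
Definition cond_var (P : probability T R) (G : set (set T)) (Z : T -> R)
    : set (T -> R) :=
  [set (fun w => S w - M w ^+ 2) |
    S in cond_exp P G (fun w => Z w ^+ 2) & M in cond_exp P G Z].

(* Almost sure equality with a random variable defined up to null sets and
   given by the set C of its versions. *)
Definition as_eq (P : probability T R) (C : set (T -> R)) (Y : T -> R) : Prop :=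
  exists2 M, C M & {ae P, forall w, M w = Y w}.

End process.

(* Main.v *)
Require Import Defs.
From HB Require Import structures.
From mathcomp Require Import all_boot all_order all_algebra.
From mathcomp Require Import all_classical all_reals all_analysis.
From mathcomp Require Import measurable_realfun ring lra.
Import Order.TTheory GRing.Theory Num.Theory.
Import numFieldNormedType.Exports.
Local Open Scope classical_set_scope.
Local Open Scope ring_scope.

Set Implicit Arguments.
Unset Strict Implicit.
Unset Printing Implicit Defensive.

(* Write F_U(x) = E[U^2; |U| > x].  Take t = (64/25) s and c = 3/5, so that
   t/s = (1 + c)^2.  If |X_t - X_s| < c |X_s| and |X_s - (s/t) X_t| < c (s/t) |X_t|
   both held, then |X_s| < (s/t) (1 + c)^2 |X_s| = |X_s|, which is absurd; so one
   of the two conditional deviations is always large.  Bounding F_{X_s} and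
   F_{X_t} by the conditional second moments of these deviations, and
   absorbing the lower order terms of the conditional variances for large x,
   gives F_{X_s}(x) <= rho F_{X_s}(x / 16), where rho is of order sigma tau
   once s is chosen so that both sigma s and tau / s are small.  The hypothesis
   on sigma tau makes 16^(r - 2) rho < 1, hence E|X_s|^r < oo.  At any other
   time t, X_t or (s/t) X_t is a conditional expectation Z of X_s, and
   F_Z(2x) <= 4 F_{X_s}(x). *)

(** * Conditional expectations and variances *)

Section subsigma.
Context {d : measure_display} {T : measurableType d} {R : realType}.
Variables (P : probability T R) (C : set (set T)).
Hypothesis CM : C `<=` measurable.
Local Notation G := (<<s C >>).

Lemma sub_sigma_measurable A : G A -> measurable A.
Proof.
by move=> GA; apply: (smallest_sub _ CM GA); exact: sigma_algebra_measurable.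
Qed.

Lemma measurable_fun_subsigma (f : T -> R) :
  preimage_set_system setT f measurable `<=` G <->
  measurable_fun setT (f : g_sigma_algebraType C -> R).
Proof.
split=> [fG _ B mB|mf A [B mB <-]]; last exact: mf.
by apply: fG; exists B.
Qed.

Lemma subsigma_measurable_fun (f : T -> R) :
  measurable_fun setT (f : g_sigma_algebraType C -> R) -> measurable_fun setT f.
Proof. by move=> mf _ B mB; apply: sub_sigma_measurable; exact: mf. Qed.

Variable H : T -> R.
Hypothesis iH : P.-integrable setT (EFin \o H).
Hypothesis H0 : forall A, G A -> (\int[P]_(w in A) (H w)%:E = 0)%E.

Import HBNNSimple.

(** A simple function is a finite combination of indicators of its level sets. These lie in [G],
    where [H] integrates to zero, so linearity suffices. *)
Let integral_nnsfun_mul (f : {nnsfun g_sigma_algebraType C >-> R}) :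
  (\int[P]_w (f w * H w)%:E = 0)%E.
Proof.
have GA y : G (f @^-1` [set y]).
  by rewrite -[X in _ X]setTI; exact: (@measurable_funPT _ _ _ _ f).
have mA y := sub_sigma_measurable (GA y).
have iA y : P.-integrable setT (fun w => (\1_(f @^-1` [set y]) w * H w)%:E).
  under eq_fun do rewrite EFinM.
  apply: (@integrableMr _ _ _ _ _ measurableT
    (\1_(f @^-1` [set y]) : T -> R)) => //.
  exists 1; split => // M M1 w _ /=; rewrite indicE.
  by case: (_ \in _); rewrite ?normr1 ?normr0 ltW// (lt_trans _ M1).
transitivity (\int[P]_w \sum_(y <- finmap.enum_fset (fset_set (range f)))
    (y%:E * (\1_(f @^-1` [set y]) w * H w)%:E))%E.
  apply: eq_integral => w _; rewrite fimfunE fsbig_finite//= mulr_suml -sumEFin.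
  by apply: eq_bigr => y _; rewrite -mulrA.
rewrite integral_sum//; last by move=> y; exact: integrableZl.
apply: big1 => y _; rewrite integralZl//.
rewrite [X in (_ * X)%E](_ : _ = 0)%E ?mule0//.
rewrite -(H0 (GA y)) [RHS]integral_mkcond; apply: eq_integral => w _.
by rewrite patchE indicE; case: (_ \in _); rewrite ?mul1r ?mul0r.
Qed.

(** The reduction to [W >= 0] splits [W] into [funrpos W] and [funrneg W], both dominated by [|W|].
    A nonnegative [W] is the increasing limit of [G]-simple functions, and dominated convergence
    applies with [|W H|] as dominating function. *)
Lemma integral_subsigma_mul0 (W : T -> R) :
  measurable_fun setT (W : g_sigma_algebraType C -> R) ->
  P.-integrable setT (fun w => (W w * H w)%:E) ->
  (\int[P]_w (W w * H w)%:E = 0)%E.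
Proof.
move=> mW iW; wlog W0 : W mW iW / forall w, 0 <= W w.
  move=> wl.
  have iWa : P.-integrable setT (fun w => (`|W w| * `|H w|)%:E).
    have -> : (fun w => (`|W w| * `|H w|)%:E) = (abse \o (fun w => (W w * H w)%:E)).
      by apply/funext => w /=; rewrite -normrM.
    exact: integrable_abse.
  have mH : measurable_fun setT H by apply/measurable_EFinP; case/integrableP: iH.
  have part (V : T -> R) : measurable_fun setT (V : g_sigma_algebraType C -> R) ->
      (forall w, 0 <= V w <= `|W w|) ->
      P.-integrable setT (fun w => (V w * H w)%:E) /\
      (\int[P]_w (V w * H w)%:E = 0)%E.
    move=> mV V0; suff iV : P.-integrable setT (fun w => (V w * H w)%:E).
      by split=> //; apply: wl => // w; case/andP: (V0 w).
    apply: le_integrable iWa => //.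
      apply/measurable_EFinP/measurable_funM => //.
      exact: subsigma_measurable_fun.
    move=> w _ /=; rewrite lee_fin normrM [leRHS]ger0_norm ?mulr_ge0//.
    by have /andP[? ?] := V0 w; rewrite ler_wpM2r// ger0_norm.
  have [ip p0] : P.-integrable setT (fun w => (funrpos W w * H w)%:E) /\
      (\int[P]_w (funrpos W w * H w)%:E = 0)%E.
    apply: part; first exact: measurable_funrpos.
    by move=> w; rewrite /funrpos le_max lexx orbT /= ge_max ler_norm normr_ge0.
  have [im m0] : P.-integrable setT (fun w => (funrneg W w * H w)%:E) /\
      (\int[P]_w (funrneg W w * H w)%:E = 0)%E.
    apply: part; first exact: measurable_funrneg.
    move=> w; rewrite /funrneg le_max lexx orbT /= ge_max normr_ge0 andbT.
    by rewrite -normrN ler_norm.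
  transitivity (\int[P]_w ((funrpos W w * H w)%:E - (funrneg W w * H w)%:E))%E.
    apply: eq_integral => w _; rewrite -EFinB -mulrBl; congr (_ * _)%:E.
    by rewrite -{1}(funrposBneg W).
  by rewrite integralB// p0 m0 sube0.
have mH : measurable_fun setT H by apply/measurable_EFinP; case/integrableP: iH.
have mEW : measurable_fun setT (EFin \o W : g_sigma_algebraType C -> \bar R).
  exact/measurable_EFinP.
pose f_ n := nnsfun_approx measurableT mEW n.
have f0 n w : 0 <= f_ n w by [].
have cf w : (f_ n w) @[n --> \oo] --> W w.
  have := @cvg_nnsfun_approx _ _ _ _ measurableT _ mEW (fun x _ => W0 x) w Logic.I.
  by move/fine_cvg.
have fW n w : f_ n w <= W w.
  have /cvg_lim <- // := cf w.
  apply: nondecreasing_cvgn_le; last by apply/cvg_ex; exists (W w).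
  by move=> m k mk; have /lefP := @nd_nnsfun_approx _ _ _ _ measurableT _ mEW _ _ mk.
have [//|||||_ _] := @dominated_convergence _ _ _ P _ measurableT
    (fun n w => (f_ n w * H w)%:E) (fun w => (W w * H w)%:E)
    (abse \o (fun w => (W w * H w)%:E)).
- move=> n; apply/measurable_EFinP/measurable_funM => //.
  by apply: subsigma_measurable_fun; exact: measurable_funPT.
- by apply/measurable_EFinP/measurable_funM => //; exact: subsigma_measurable_fun.
- apply: aeW => w _; apply/fine_cvgP; split; first exact: nearW.
  by apply: cvgM; [exact: cf|exact: cvg_cst].
- exact: integrable_abse.
- apply: aeW => w n _ /=; rewrite lee_fin !normrM ler_wpM2r//.
  by rewrite !ger0_norm.
- under eq_fun do rewrite integral_nnsfun_mul.
  by move=> /cvg_lim <- //; rewrite lim_cst.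
Qed.

End subsigma.

(** * Conditional means and variances of square-integrable variables *)

Section square_integrable.
Context {d : measure_display} {T : measurableType d} {R : realType}.
Variable P : probability T R.

Lemma Lfun_measurable p (f : T -> R) : f \in Lfun P p -> measurable_fun setT f.
Proof. by rewrite inE => /andP[/[!inE]/= mf _]. Qed.

Lemma Lfun2_integrable_mul (f g : T -> R) :
  f \in Lfun P 2%:E -> g \in Lfun P 2%:E ->
  P.-integrable setT (EFin \o (fun w => f w * g w)).
Proof. by move=> f2 g2; apply/Lfun1_integrable; exact: Lfun2_mul_Lfun1. Qed.

Lemma Lfun2_integrable (f : T -> R) :
  f \in Lfun P 2%:E -> P.-integrable setT (EFin \o f).
Proof.
move=> f2; apply/Lfun1_integrable; apply: Lfun_subset12 => //.
exact: fin_num_measure.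
Qed.

Lemma Lfun2_scale (k : R) (f : T -> R) :
  f \in Lfun P 2%:E -> (fun w => k * f w) \in Lfun P 2%:E.
Proof.
move=> f2; rewrite (_ : (fun w => _) = k \o* f); last first.
  by apply/funext => w /=; rewrite mulrC.
by apply: Lfun_scale => //; rewrite ler1n.
Qed.

Lemma Lfun2_sub (f g : T -> R) : f \in Lfun P 2%:E -> g \in Lfun P 2%:E ->
  (fun w => f w - g w) \in Lfun P 2%:E.
Proof. by move=> f2 g2; rewrite (_ : (fun w => _) = f - g)// rpredB ?lee1n. Qed.

Lemma integrable_set (f : T -> R) A : measurable A ->
  P.-integrable setT (EFin \o f) -> P.-integrable A (EFin \o f).
Proof. by move=> mA; exact: integrableS. Qed.

Variable C : set (set T).
Hypothesis CM : C `<=` measurable.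
Local Notation G := (<<s C >>).

(** Almost sure uniqueness of conditional expectation: the difference [D] is orthogonal to its own
    sign, which is [G]-measurable, so the integral of [|D|] vanishes. *)
Lemma ae_eq_subsigma (f g : T -> R) :
  preimage_set_system setT f measurable `<=` G ->
  preimage_set_system setT g measurable `<=` G ->
  P.-integrable setT (EFin \o f) -> P.-integrable setT (EFin \o g) ->
  (forall A, G A -> (\int[P]_(w in A) (f w)%:E = \int[P]_(w in A) (g w)%:E)%E) ->
  {ae P, forall w, f w = g w}.
Proof.
move=> /measurable_fun_subsigma mf /measurable_fun_subsigma mg if_ ig fg.
pose D w := f w - g w.
have iD : P.-integrable setT (EFin \o D) by exact: (integrableB measurableT if_ ig).
have mD : measurable_fun setT (D : g_sigma_algebraType C -> R).
  exact: measurable_funB.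
have D0 A : G A -> (\int[P]_(w in A) (D w)%:E = 0)%E.
  move=> GA; have mA := sub_sigma_measurable CM GA.
  rewrite /D integralB_EFin//; [|exact: integrable_set..].
  rewrite fg// subee// integrable_fin_num//; exact: integrable_set.
(* [W] is the sign of [D], with value 1 where [D] vanishes. *)
pose W w : R := 2 * \1_[set w | 0 <= D w] w - 1.
have WD w : W w * D w = `|D w|.
  rewrite /W indicE; have [D0w|D0w] := leP 0 (D w).
    by rewrite mem_set// ger0_norm// mulr1; ring.
  by rewrite memNset/= ?ltr0_norm//; [ring|apply/negP; rewrite -ltNge].
have mW : measurable_fun setT (W : g_sigma_algebraType C -> R).
  apply: measurable_funB => //; apply: measurable_funM => //.
  apply: measurable_indic.
  by rewrite -[X in measurable X]setTI; apply: measurable_fun_le.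
have iW : P.-integrable setT (fun w => (W w * D w)%:E).
  by under eq_fun do rewrite WD; exact: integrable_abse iD.
have := integral_subsigma_mul0 CM iD D0 mW iW.
under eq_integral do rewrite WD.
have miD : measurable_fun setT (EFin \o D) by case/integrableP: iD.
move=> /(ae_eq_integral_abs P measurableT miD).1.
apply: filterS => w /(_ Logic.I) /= [] /eqP.
by rewrite subr_eq0 => /eqP.
Qed.

Variables Y m : T -> R.
Hypotheses (Y2 : Y \in Lfun P 2%:E) (m2 : m \in Lfun P 2%:E).
Hypothesis mG : preimage_set_system setT m measurable `<=` G.
Hypothesis Ym : as_eq P (cond_exp P G Y) m.

Lemma cond_exp_integral A : G A ->
  (\int[P]_(w in A) (m w)%:E = \int[P]_(w in A) (Y w)%:E)%E.
Proof.
move=> GA; have mA := sub_sigma_measurable CM GA.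
have [M [_ iM MY] Mm] := Ym; rewrite -MY//; apply: ae_eq_integral => //.
- by apply/measurable_EFinP; apply: measurable_funTS; exact: Lfun_measurable m2.
- by case/integrableP: (integrable_set mA iM).
- by apply: filterS Mm => w /= ->.
Qed.

(** The residual [Y - m] is orthogonal to the [G]-measurable function [m] times the indicator of
    [A]. *)
Lemma cond_exp_cross A : G A ->
  \int[P]_(w in A) (m w * Y w) = \int[P]_(w in A) (m w * m w).
Proof.
move=> GA; have mA := sub_sigma_measurable CM GA.
pose H w := Y w - m w.
have H2 : H \in Lfun P 2%:E by exact: Lfun2_sub.
have iH := Lfun2_integrable H2.
have H0 B : G B -> (\int[P]_(w in B) (H w)%:E = 0)%E.
  move=> GB; have mB := sub_sigma_measurable CM GB.
  rewrite /H integralB_EFin//; [|exact: integrable_set (Lfun2_integrable _)..].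
  rewrite cond_exp_integral// subee// integrable_fin_num//.
  exact: integrable_set (Lfun2_integrable _).
have imH := Lfun2_integrable_mul m2 H2.
have E w : m w * \1_A w * H w = ((fun w => m w * H w) \_ A) w.
  by rewrite patchE indicE; case: (_ \in _); rewrite ?mulr1// mulr0 mul0r.
have I0 : (\int[P]_w (m w * \1_A w * H w)%:E = 0)%E.
  apply: (integral_subsigma_mul0 CM iH H0).
    apply: measurable_funM; first exact/measurable_fun_subsigma.
    exact: measurable_indic.
  under eq_fun do rewrite E.
  rewrite [X in P.-integrable _ X](_ : _ = (EFin \o (fun w => m w * H w)) \_ A).
    by rewrite -integrable_mkcond//; exact: integrable_set imH.
  by apply/funext => w; rewrite !patchE; case: ifP.
have : \int[P]_(w in A) (m w * H w) = 0.
  rewrite Rintegral_mkcond -[RHS](congr1 fine I0).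
  by congr fine; apply: eq_integral => w _; rewrite E.
rewrite /H; under eq_Rintegral do rewrite mulrBr.
rewrite RintegralB//; [|exact: integrable_set (Lfun2_integrable_mul _ _)..].
by move=> /eqP; rewrite subr_eq0 => /eqP.
Qed.

(** The version [M] hidden in [cond_var] agrees almost surely with [m] by uniqueness. Then
    [(Y - m)^2] is expanded: the cross term reduces to [m^2] by [cond_exp_cross], and [Y^2]
    integrates to [v + m^2] over [A]. *)
Lemma cond_var_integral (v : T -> R) A : as_eq P (cond_var P G Y) v ->
  P.-integrable setT (EFin \o v) -> G A ->
  \int[P]_(w in A) ((Y w - m w) ^+ 2) = \int[P]_(w in A) v w.
Proof.
move=> [V [S [SG iS SY] [M [MG iM MY]] <-]] SMv iv GA.
have mA := sub_sigma_measurable CM GA.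
have Mm : {ae P, forall w, M w = m w}.
  apply: ae_eq_subsigma => //; first exact: Lfun2_integrable.
  by move=> B GB; rewrite MY// cond_exp_integral.
have iYY := integrable_set mA (Lfun2_integrable_sqr Y2).
have imm := integrable_set mA (Lfun2_integrable_sqr m2).
have imY := integrable_set mA (Lfun2_integrable_mul m2 Y2).
have {}iv := integrable_set mA iv.
have YY : \int[P]_(w in A) (Y w ^+ 2) = \int[P]_(w in A) (v w + m w ^+ 2).
  congr fine; rewrite -SY//; apply: ae_eq_integral => //.
  - by case/integrableP: (integrable_set mA iS).
  - by case/integrableP: (integrableD mA iv imm).
  - by apply: filterS2 SMv Mm => w /= Sv Mw _; rewrite -Sv Mw subrK.
transitivity (\int[P]_(w in A) (Y w ^+ 2 - (2 * (m w * Y w) - m w ^+ 2))).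
  by apply: eq_Rintegral => w _; ring.
have i2mY : P.-integrable A (EFin \o (fun w => 2 * (m w * Y w))).
  exact: integrableZl imY.
rewrite RintegralB//; last exact: (integrableB mA i2mY imm).
rewrite RintegralB// RintegralZl// cond_exp_cross// YY RintegralD//.
under [X in _ - (_ * X - _)]eq_Rintegral do rewrite -expr2.
ring.
Qed.

End square_integrable.

(** * Tails of second moments *)

Section tail.
Context {d : measure_display} {T : measurableType d} {R : realType}.
Variable P : probability T R.
Implicit Types U V : T -> R.

Definition above U x : set T := [set w | x < `|U w|].

(** This is F_U(x) of the overview. *)
Definition tail2 U x : R := \int[P]_(w in above U x) (U w ^+ 2).

Lemma measurable_norm_gt (x : R) : measurable [set y : R | x < `|y|].
Proof.
rewrite [X in measurable X](_ : _ = ~` ([set: R] `&` [set y | `|y| <= x])).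
  apply: measurableC; apply: measurable_fun_le => //.
apply/seteqP; split=> y /=; rewrite ltNge; first by move/negP; tauto.
by move=> ?; apply/negP; tauto.
Qed.

Lemma measurable_above U x : measurable_fun setT U -> measurable (above U x).
Proof.
move=> mU; rewrite -[above _ _]setTI; apply: (mU measurableT [set y | x < `|y|]).
exact: measurable_norm_gt.
Qed.

Lemma tail2_ge0 U x : 0 <= tail2 U x.
Proof. by apply: Rintegral_ge0 => w _; exact: sqr_ge0. Qed.

Lemma integrable_patch U A : measurable A ->
  P.-integrable setT (EFin \o U) -> P.-integrable setT (EFin \o (U \_ A)).
Proof.
move=> mA iU; rewrite -restrict_EFin -integrable_mkcond//.
exact: integrable_set.
Qed.

(** The three integrals run over different sets; extending the integrands by zero turns the
    comparison into one pointwise inequality. *)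
Lemma Rintegral_patch_le U V W A B C a b :
  measurable A -> measurable B -> measurable C ->
  P.-integrable setT (EFin \o U) -> P.-integrable setT (EFin \o V) ->
  P.-integrable setT (EFin \o W) ->
  (forall w, (U \_ A) w <= a * (V \_ B) w + b * (W \_ C) w) ->
  \int[P]_(w in A) U w <=
    a * (\int[P]_(w in B) V w) + b * (\int[P]_(w in C) W w).
Proof.
move=> mA mB mC iU iV iW UVW.
rewrite Rintegral_mkcond (Rintegral_mkcond _ B) (Rintegral_mkcond _ C).
have iA := integrable_patch mA iU.
have iB := integrable_patch mB iV.
have iC := integrable_patch mC iW.
rewrite -RintegralZl// -[X in _ + X]RintegralZl// -RintegralD//.
- apply: le_Rintegral => //.
  exact: (integrableD measurableT (integrableZl _ a iB) (integrableZl _ b iC)).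
- exact: (integrableZl measurableT a iB).
- exact: (integrableZl measurableT b iC).
Qed.

(** Pointwise form of the dichotomy, with [p u] and [q v] in the role of the conditional means of
    [v] and [u]. A small first deviation puts [|v|] between [p (1 - c) |u|] and [p (1 + c) |u|]. If
    moreover [|u - q v| < c q |v|], then [|u| < q (1 + c) |v| <= p q (1 + c)^2 |u| <= |u|], a
    contradiction; so [|u - q v|] is at least [c q |v|], hence at least a multiple of [|u|]. *)
Lemma sqr_le_two_step (u v p q c : R) : 0 < p -> 0 < q -> 0 < c -> c < 1 ->
  p * q * (1 + c) ^+ 2 <= 1 -> `|v - p * u| < c * p * `|u| ->
  p * (1 - c) * `|u| < `|v| /\
  u ^+ 2 <= (c * q * (p * (1 - c))) ^- 2 * (u - q * v) ^+ 2.
Proof.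
move=> p0 q0 c0 c1 pq vpu.
have pu : `|p * u| = p * `|u| by rewrite normrM gtr0_norm.
have qv : `|q * v| = q * `|v| by rewrite normrM gtr0_norm.
have lv : p * (1 - c) * `|u| < `|v|.
  have : p * `|u| <= `|v - p * u| + `|v|.
    by rewrite -pu distrC; have := ler_normD (p * u - v) v; rewrite subrK.
  by lra.
have uv : `|v| < p * (1 + c) * `|u|.
  have := ler_normD (v - p * u) (p * u); rewrite subrK pu; lra.
split=> //.
have k0 : 0 < c * q * (p * (1 - c)) by rewrite !mulr_gt0// subr_gt0.
rewrite mulrC ler_pdivlMr ?exprn_gt0// -exprMn.
rewrite -[leLHS]real_normK ?num_real// -[leRHS]real_normK ?num_real//.
rewrite lerXn2r ?nnegrE//.
rewrite normrM (gtr0_norm k0).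
apply: (@le_trans _ _ (c * q * `|v|)).
  by rewrite mulrC -(mulrA (c * q)) ler_wpM2l// ltW// mulr_gt0.
rewrite leNgt; apply/negP => uqv.
have : `|u| < q * (1 + c) * `|v|.
  have := ler_normD (u - q * v) (q * v); rewrite subrK qv; lra.
have u0 := normr_ge0 u.
have : q * (1 + c) * `|v| <= p * q * (1 + c) ^+ 2 * `|u|.
  rewrite (_ : p * q * (1 + c) ^+ 2 * `|u| = q * (1 + c) * (p * (1 + c) * `|u|)).
    by rewrite ler_wpM2l ?(ltW uv)// ltW// mulr_gt0// addr_gt0.
  by ring.
have : p * q * (1 + c) ^+ 2 * `|u| <= `|u| by rewrite ler_piMl.
lra.
Qed.

(** The event [|U| > x] is split according to whether [|V - p U|] reaches [c p |U|]. Where it does,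
    [U^2] is controlled by the first deviation; elsewhere [|V| > p (1 - c) x] and the second
    deviation controls [U^2]. *)
Lemma tail2_step U V p q c a b x : 0 < p -> 0 < q -> 0 < c -> c < 1 ->
  p * q * (1 + c) ^+ 2 <= 1 -> 0 <= x ->
  U \in Lfun P 2%:E -> V \in Lfun P 2%:E ->
  \int[P]_(w in above U x) ((V w - p * U w) ^+ 2) <= a * tail2 U x ->
  \int[P]_(w in above V (p * (1 - c) * x)) ((U w - q * V w) ^+ 2) <=
    b * tail2 V (p * (1 - c) * x) ->
  tail2 U x <= a / (c * p) ^+ 2 * tail2 U x +
    b / (c * q * (p * (1 - c))) ^+ 2 * tail2 V (p * (1 - c) * x).
Proof.
move=> p0 q0 c0 c1 pq x0 U2 V2 HU HV.
set y := p * (1 - c) * x.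
have k1 : 0 < (c * p) ^+ 2 by rewrite exprn_gt0 ?mulr_gt0.
have k2 : 0 < (c * q * (p * (1 - c))) ^+ 2.
  by rewrite exprn_gt0// !mulr_gt0// subr_gt0.
have mAU := measurable_above x (Lfun_measurable U2).
have mAV := measurable_above y (Lfun_measurable V2).
apply: (@le_trans _ _ ((c * p) ^- 2 *
    (\int[P]_(w in above U x) ((V w - p * U w) ^+ 2)) +
  (c * q * (p * (1 - c))) ^- 2 *
    (\int[P]_(w in above V y) ((U w - q * V w) ^+ 2)))); last first.
  by apply: lerD; rewrite [leRHS]mulrAC [leRHS]mulrC ler_wpM2l// invr_ge0 ltW.
apply: Rintegral_patch_le => //.
- exact: Lfun2_integrable_sqr.
- exact: Lfun2_integrable_sqr (Lfun2_sub V2 (Lfun2_scale p U2)).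
- exact: Lfun2_integrable_sqr (Lfun2_sub U2 (Lfun2_scale q V2)).
move=> w; rewrite !patchE.
have t0 : 0 <= (c * q * (p * (1 - c))) ^- 2 *
    (if w \in above V y then (U w - q * V w) ^+ 2 else 0).
  by rewrite mulr_ge0 ?invr_ge0 ?(ltW k2)//; case: ifP => // _; exact: sqr_ge0.
case: ifPn => [|_]; last by rewrite mulr0 add0r.
rewrite inE /above /= => xU.
have [cU|Uc] := leP (c * p * `|U w|) `|V w - p * U w|.
  rewrite -[leLHS]addr0 lerD// mulrC ler_pdivlMr// -exprMn.
  rewrite -[leLHS]real_normK ?num_real// -[leRHS]real_normK ?num_real//.
  rewrite lerXn2r ?nnegrE//.
  by rewrite normrM mulrC ger0_norm// mulr_ge0 ?ltW.
have [Uy UV] := sqr_le_two_step p0 q0 c0 c1 pq Uc.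
rewrite mem_set /=; last first.
  rewrite /y; apply: le_lt_trans Uy; rewrite ler_wpM2l ?(ltW xU)//.
  by rewrite mulr_ge0 ?ltW// subr_gt0.
by rewrite -[leLHS]add0r lerD// mulr_ge0 ?sqr_ge0// invr_ge0 ltW.
Qed.

End tail.

(** * From tail contraction to finite moments *)

Section tail_decay.
Context {d : measure_display} {T : measurableType d} {R : realType}.
Variable P : probability T R.
Implicit Types U V Z Y : T -> R.

(** [tail2_step] is applied to [(U, V)] at level [x] and to [(V, U)] at level [p (1 - c) x], and the
    tail of [V] is eliminated. The factors [1 - a] and [1 - b] arise from moving each tail that
    occurs on both sides to the left. *)
Lemma tail2_two_steps U V p q c a b x0 x : 0 < p -> 0 < q -> 0 < c -> c < 1 ->
  p * q * (1 + c) ^+ 2 <= 1 -> 0 <= b -> b < 1 -> 0 <= x0 ->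
  x0 <= x -> x0 <= p * (1 - c) * x -> x0 <= p * q * (1 - c) ^+ 2 * x ->
  U \in Lfun P 2%:E -> V \in Lfun P 2%:E ->
  (forall y, x0 <= y ->
    \int[P]_(w in above U y) ((V w - p * U w) ^+ 2) <=
      a * (c * p) ^+ 2 * tail2 P U y) ->
  (forall y, x0 <= y ->
    \int[P]_(w in above V y) ((U w - q * V w) ^+ 2) <=
      b * (c * q) ^+ 2 * tail2 P V y) ->
  (1 - a) * (1 - b) * tail2 P U x <=
    a * b / (p * q * (1 - c) ^+ 2) ^+ 2 * tail2 P U (p * q * (1 - c) ^+ 2 * x).
Proof.
move=> p0 q0 c0 c1 pq b0 b1 x00 x0x x0y x0z U2 V2 HU HV.
set y := p * (1 - c) * x in x0y.
have c1' : 0 < 1 - c by rewrite subr_gt0.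
have zE : p * q * (1 - c) ^+ 2 * x = q * (1 - c) * y by rewrite /y; ring.
rewrite zE in x0z *.
have step1 := tail2_step p0 q0 c0 c1 pq (le_trans x00 x0x) U2 V2
  (HU _ x0x) (HV _ x0y).
have qp : q * p * (1 + c) ^+ 2 <= 1 by rewrite (mulrC q).
have step2 := tail2_step q0 p0 c0 c1 qp (le_trans x00 x0y) V2 U2
  (HV _ x0y) (HU _ x0z).
(* The factors [(c p)^2] and [(c q)^2] in the hypotheses cancel the denominators of [tail2_step],
   leaving only [p (1 - c)] and [q (1 - c)]. *)
have simp e f g : 0 < f -> 0 < g ->
    e * (c * f) ^+ 2 / (c * f * g) ^+ 2 = e / g ^+ 2.
  by move=> f0 g0; field; rewrite !gt_eqF.
rewrite -/y in step1; move: step1 step2.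
rewrite !simp ?mulr_gt0// !mulfK ?expf_neq0 ?gt_eqF ?mulr_gt0//.
move: (tail2 P U x) (tail2 P V y) (tail2 P U _) => A B D AB BD.
have k1 : 0 <= b / (p * (1 - c)) ^+ 2 by rewrite divr_ge0 ?sqr_ge0.
have -> : a * b / (p * q * (1 - c) ^+ 2) ^+ 2 =
    b / (p * (1 - c)) ^+ 2 * (a / (q * (1 - c)) ^+ 2).
  by field; rewrite !gt_eqF.
move: (_ / (p * _) ^+ 2) (_ / (q * _) ^+ 2) k1 AB BD => k l k0 AB BD.
apply: (@le_trans _ _ ((1 - b) * (k * B))).
  rewrite (mulrC (1 - a)) -mulrA ler_wpM2l ?subr_ge0 ?(ltW b1)//; lra.
rewrite mulrCA -mulrA ler_wpM2l//; lra.
Qed.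

(* The constants satisfy 25/64 (1 + 3/5)^2 = 1 and 25/64 (1 - 3/5)^2 = 1/16. *)
Lemma tail2_contraction U V a b x0 x : 0 <= b -> b < 1 ->
  0 <= x0 -> 16 * x0 <= x ->
  U \in Lfun P 2%:E -> V \in Lfun P 2%:E ->
  (forall y, x0 <= y ->
    \int[P]_(w in above U y) ((V w - 1 * U w) ^+ 2) <=
      a * (3 / 5 * 1) ^+ 2 * tail2 P U y) ->
  (forall y, x0 <= y ->
    \int[P]_(w in above V y) ((U w - 25 / 64 * V w) ^+ 2) <=
      b * (3 / 5 * (25 / 64)) ^+ 2 * tail2 P V y) ->
  (1 - a) * (1 - b) * tail2 P U x <= 256 * (a * b) * tail2 P U (x / 16).
Proof.
move=> b0 b1 x00 x0x U2 V2 HU HV.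
have pq : 1 * (25 / 64) * (1 - 3 / 5) ^+ 2 = 1 / 16 :> R by field.
have := tail2_two_steps (p := 1) (q := 25 / 64) (c := 3 / 5) (x0 := x0) (x := x)
  _ _ _ _ _ b0 b1 x00 _ _ _ U2 V2 HU HV.
rewrite pq (_ : a * b / (1 / 16) ^+ 2 = 256 * (a * b)); last by field.
by rewrite (_ : 1 / 16 * x = x / 16); [apply; lra | rewrite mulrC mul1r].
Qed.

(** The region [|U| > x1] is cut into shells [x1 16^n < |U| <= x1 16^(n+1)]. On each shell
    [|U|^(r-2)] is at most a constant times [16^(n (r-2))], so the moment is dominated by [x1^r]
    plus a geometric series of ratio [16^(r-2) rho]. *)
Lemma fin_moment_of_decay U r x1 C rho : 2 <= r -> 0 < x1 ->
  U \in Lfun P 2%:E -> 0 <= rho -> 16 `^ (r - 2) * rho < 1 ->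
  (forall n, tail2 P U (x1 * 16 ^+ n) <= C * rho ^+ n) ->
  (\int[P]_w (`|U w| `^ r)%R%:E < +oo)%E.
Proof.
move=> r2 x10 U2 rho0 krho UC.
have mU := Lfun_measurable U2.
have mA n := @measurable_above _ _ _ U (x1 * 16 ^+ n) mU.
pose k : R := 16 `^ (r - 2).
(* [w_ n] is the value of [|U|^(r-2)] at the outer edge of the [n]-th shell. *)
pose w_ n := (16 * x1) `^ (r - 2) * k ^+ n.
have w0 n : 0 <= w_ n by rewrite mulr_ge0 ?powR_ge0// exprn_ge0 ?powR_ge0.
pose g n w := (w_ n * ((fun w => U w ^+ 2) \_ (above U (x1 * 16 ^+ n))) w)%:E.
have g0 n w : (0 <= g n w)%E.
  by rewrite lee_fin mulr_ge0// patchE; case: ifP => // _; exact: sqr_ge0.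
have mg n : measurable_fun setT (g n).
  apply/measurable_EFinP/measurable_funM => //.
  apply/(measurable_restrictT _ (mA n)).1.
  exact/measurable_funTS/measurable_funX.
have ig n : (\int[P]_w g n w = (w_ n * tail2 P U (x1 * 16 ^+ n))%:E)%E.
  rewrite /g; under eq_integral do rewrite EFinM.
  have iU := integrable_patch (mA n) (Lfun2_integrable_sqr U2).
  rewrite integralZl// [RHS]EFinM; congr (_ * _)%E.
  rewrite /tail2 Rintegral_mkcond /Rintegral fineK//.
  exact: integrable_fin_num.
have le_pt w : ((`|U w| `^ r)%R%:E <= (x1 `^ r)%R%:E + \sum_(n <oo) g n w)%E.
  have s0 : (0 <= \sum_(n <oo) g n w)%E by apply: nneseries_ge0.
  have [Ux|xU] := leP `|U w| x1.
    rewrite -[leLHS]adde0 leeD// lee_fin ge0_ler_powR ?nnegrE ?(ltW x10)//.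
    by rewrite (le_trans _ r2).
  have ex : exists n, `|U w| <= x1 * 16 ^+ n.
    (* This exponent is large enough because [m < 16^m]; the least admissible exponent then
       identifies the shell. *)
    exists (Num.truncn (`|U w| / x1)).+1.
    rewrite mulrC -ler_pdivrMr// (le_trans (ltW (truncnS_gt _)))//.
    by rewrite -natrX ler_nat ltnW// ltn_expl.
  case: (ex_minnP ex) => -[|n]; first by rewrite expr0 mulr1 leNgt xU.
  move=> Un nmin.
  have nU : x1 * 16 ^+ n < `|U w|.
    by rewrite ltNge; apply/negP => /nmin; rewrite ltnn.
  apply: (@le_trans _ _ (g n w)); last first.
    rewrite -[leLHS]add0e leeD ?lee_fin ?powR_ge0//.
    rewrite (nneseriesD1 (n := n))// -[leLHS]adde0 leeD//.
    exact: nneseries_ge0.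
  rewrite lee_fin patchE mem_set//.
  have U0 : 0 < `|U w| by rewrite (lt_trans x10).
  have -> : `|U w| `^ r = `|U w| `^ (r - 2) * U w ^+ 2.
    rewrite -[U w ^+ 2]real_normK ?num_real// -powR_mulrn// -powRD ?subrK//.
    by rewrite (gt_eqF U0) implybT.
  rewrite ler_wpM2r ?sqr_ge0// /w_ /k -powR_mulrn ?powR_ge0// powRAC.
  rewrite powR_mulrn// -powRM ?mulr_ge0 ?exprn_ge0 ?(ltW x10)//.
  rewrite ge0_ler_powR ?nnegrE ?subr_ge0 ?mulr_ge0 ?exprn_ge0 ?(ltW x10)//.
  by rewrite (le_trans Un)// exprS mulrA (mulrC x1).
have ms : measurable_fun setT (fun w => \sum_(n <oo) g n w)%E.
  exact: ge0_emeasurable_sum.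
apply: (@le_lt_trans _ _ (\int[P]_w ((x1 `^ r)%R%:E + \sum_(n <oo) g n w))%E).
  apply: ge0_le_integral => //.
  - apply/measurable_EFinP.
    apply: (@measurableT_comp _ _ _ _ _ _ (fun x : R => x `^ r)) => //.
    exact: measurableT_comp.
  - exact: emeasurable_funD.
rewrite ge0_integralD//; last first.
- by move=> w _; rewrite nneseries_ge0.
- by move=> w _; rewrite lee_fin powR_ge0.
rewrite integral_cst// integral_nneseries// lte_add_pinfty//.
  by rewrite lte_mul_pinfty ?lee_fin ?powR_ge0// ltey_eq fin_num_measure.
pose A := (16 * x1) `^ (r - 2) * C.
apply: (@le_lt_trans _ _ (\sum_(n <oo) (geometric A (k * rho) n)%:E)%E).
  apply: lee_nneseries => [n _ _|n _]; first exact: integral_ge0.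
  rewrite ig lee_fin /= /w_ /A exprMn.
  rewrite [leRHS](_ : _ = (16 * x1) `^ (r - 2) * k ^+ n * (C * rho ^+ n));
    last by ring.
  by rewrite ler_wpM2l ?UC//; exact: w0.
have kr : `|k * rho| < 1 by rewrite ger0_norm// mulr_ge0 ?powR_ge0.
have /cvg_lim -> // : (fun n => \sum_(0 <= i < n) (geometric A (k * rho) i)%:E)%E
    @ \oo --> (A * (1 - k * rho)^-1)%:E.
  under eq_fun do rewrite sumEFin.
  by apply: cvg_EFin; [exact: nearW | exact: cvg_geometric_series].
by rewrite ltry.
Qed.

(** On [|Z| > 2 x], the product [Z Y] is at most [Z^2 / 2] if [|Y| <= x], and at most
    [Z^2 / 4 + Y^2] otherwise, the latter from [(Z / 2 - Y)^2 >= 0]. Since [Z Y] integrates to the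
    tail of [Z], three quarters of that tail can be absorbed. *)
Lemma tail2_transfer Z Y x : 0 <= x ->
  Z \in Lfun P 2%:E -> Y \in Lfun P 2%:E ->
  \int[P]_(w in above Z (2 * x)) (Z w * Y w) =
    \int[P]_(w in above Z (2 * x)) (Z w * Z w) ->
  tail2 P Z (2 * x) <= 4 * tail2 P Y x.
Proof.
move=> x0 Z2 Y2 ZY.
have : \int[P]_(w in above Z (2 * x)) (Z w * Y w) <=
    3 / 4 * tail2 P Z (2 * x) + 1 * tail2 P Y x.
  apply: Rintegral_patch_le.
  - exact: measurable_above (Lfun_measurable Z2).
  - exact: measurable_above (Lfun_measurable Z2).
  - exact: measurable_above (Lfun_measurable Y2).
  - exact: Lfun2_integrable_mul.
  - exact: Lfun2_integrable_sqr.
  - exact: Lfun2_integrable_sqr.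
  move=> w; rewrite !patchE mul1r.
  have Y0 : 0 <= if w \in above Y x then Y w ^+ 2 else 0.
    by case: ifP => // _; exact: sqr_ge0.
  case: ifPn => [|_]; last by rewrite mulr0 add0r.
  rewrite inE /above /= => xZ.
  have [Yx|xY] := leP `|Y w| x.
    rewrite -[leLHS]addr0 lerD// (le_trans (ler_norm _))// normrM.
    rewrite -(real_normK (num_real (Z w))).
    by have := normr_ge0 (Z w); nra.
  rewrite mem_set//.
  by have := sqr_ge0 (Z w / 2 - Y w); nra.
rewrite ZY; under eq_Rintegral do rewrite -expr2.
rewrite -/(tail2 P Z (2 * x)); lra.
Qed.

End tail_decay.

(** * Quadratic harnesses *)

Section arithmetic.
Context {R : realType}.
Implicit Types A B D e z sigma tau : R.

(** Once [|z| >= 1] and [e |z| >= |B| + |D|], the lower order terms are at most [e z^2]. *)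
Lemma quadratic_le_leading A B D e : 0 < e ->
  exists2 x0, 0 < x0 & forall z, x0 <= `|z| ->
    A * z ^+ 2 + B * z + D <= (A + e) * z ^+ 2.
Proof.
move=> e0; have B0 := normr_ge0 B; have D0 := normr_ge0 D.
have q0 : 0 <= (`|B| + `|D|) / e by rewrite divr_ge0 ?addr_ge0// ltW.
exists (1 + (`|B| + `|D|) / e) => [|z zx]; first by lra.
have z1 : 1 <= `|z| by lra.
have ez : `|B| + `|D| <= e * `|z| by rewrite mulrC -ler_pdivrMr//; lra.
have Bz : B * z <= `|B| * `|z| by rewrite -normrM ler_norm.
have DD := ler_norm D.
have Dz : `|D| <= `|D| * `|z| by rewrite ler_peMr.
have : (`|B| + `|D|) * `|z| <= e * z ^+ 2.
  by rewrite -[z ^+ 2]real_normK ?num_real// expr2 mulrA ler_wpM2r.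
lra.
Qed.

(** With [t = 64/25 s] one has [t - s = 39/25 s] and [(t - s) / t = 39/64], so the two quantities
    govern the leading coefficients of the forward and backward variances. For [tau > 0] the choice
    [s = 512 tau] makes the second one small, and the bound on [sigma tau] makes the first one
    small. *)
Lemma balanced_time sigma tau : 0 <= sigma -> 0 <= tau ->
  512 * 512 * (sigma * tau) <= 1 ->
  exists2 s, 0 < s & 39 / 25 * sigma * s <= 1 / 256 /\ 39 / 64 * tau / s <= 1 / 256.
Proof.
move=> s0 t0 st.
have [t_gt0|] := ltP 0 tau.
  exists (512 * tau); first by lra.
  split; first by lra.
  rewrite [leLHS](_ : _ = 39 / (64 * 512)); first by lra.
  by field; rewrite gt_eqF.
move=> t_le0; have -> : tau = 0 by lra.
exists (512 * (sigma + 1))^-1; first by rewrite invr_gt0; lra.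
rewrite mulr0 mul0r; split; last by lra.
by rewrite ler_pdivrMr; lra.
Qed.

(** Here [N] stands for [16^r] and [3/5] is the constant [c]. Both [a] and [b] are at most [1/40]
    and [a b <= 16 e], so [N a b <= 1/64], while [(1 - a) (1 - b) >= 9/10]. *)
Lemma contraction_rate (N al be e : R) : 0 < N -> 256 <= N ->
  0 <= al -> al <= 1 / 256 -> 0 <= be -> be <= 1 / 256 ->
  e = (1024 * N)^-1 -> al * be <= e ->
  let a := (al + e) / (3 / 5) ^+ 2 in let b := (be + e) / (3 / 5) ^+ 2 in
  [/\ a < 1, b < 1 & N * (a * b) < (1 - a) * (1 - b)].
Proof.
move=> N0 N256 al0 al1 be0 be1 eE ab a b.
have e0 : 0 < e by rewrite eE invr_gt0; lra.
have Ne : N * e = 1 / 1024 by rewrite eE; field; rewrite gt_eqF.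
have e1 : e <= 1 / 256 by nra.
have aE : a = 25 / 9 * (al + e) by rewrite /a; field.
have bE : b = 25 / 9 * (be + e) by rewrite /b; field.
have a1 : a <= 1 / 40 by rewrite aE; lra.
have b1 : b <= 1 / 40 by rewrite bE; lra.
split; [lra|lra|].
have abe : a * b <= 16 * e by rewrite aE bE; nra.
have : N * (a * b) <= 1 / 64.
  apply: (@le_trans _ _ (N * (16 * e))); first by rewrite ler_wpM2l// ltW.
  by rewrite mulrCA Ne; lra.
have : 9 / 10 <= (1 - a) * (1 - b) by nra.
lra.
Qed.

End arithmetic.

(** * Past and future of a process, treated alike through the time set [I] *)

Section process.
Context {d : measure_display} {T : measurableType d} {R : realType}.
Variables (P : probability T R) (X : R -> T -> R) (I : set R).
Hypothesis XI : forall t, I t -> X t \in Lfun P 2%:E.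

Let gens := \bigcup_(t in I) preimage_set_system setT (X t) measurable.

Lemma process_gens_measurable : gens `<=` measurable.
Proof. by move=> A [t It [B mB <-]]; exact: (Lfun_measurable (XI It)). Qed.

Lemma process_sigma_adapted t : I t ->
  measurable_fun setT (X t : g_sigma_algebraType gens -> R).
Proof.
move=> It; apply/measurable_fun_subsigma => A XA.
by apply: sub_gen_smallest; exists t.
Qed.

Variables (t : R) (k : R) (Y : T -> R).
Hypotheses (It : I t) (Y2 : Y \in Lfun P 2%:E).
Let m w := k * X t w.
Hypothesis Ym : as_eq P (cond_exp P (process_sigma X I) Y) m.

Let m2 : m \in Lfun P 2%:E. Proof. exact: Lfun2_scale (XI It). Qed.

Let mm : measurable_fun setT (m : g_sigma_algebraType gens -> R).
Proof. by apply: measurable_funM => //; exact: process_sigma_adapted. Qed.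

Lemma process_sigma_above x : process_sigma X I (above (X t) x).
Proof.
rewrite -[above _ _]setTI.
exact: (process_sigma_adapted It measurableT (measurable_norm_gt x)).
Qed.

Lemma process_tail2_transfer x : 0 <= x -> tail2 P m (2 * x) <= 4 * tail2 P Y x.
Proof.
move=> x0; apply: tail2_transfer => //.
apply: (cond_exp_cross process_gens_measurable Y2 m2 _ Ym).
  exact/measurable_fun_subsigma.
rewrite -[above _ _]setTI.
exact: (mm measurableT (measurable_norm_gt (2 * x))).
Qed.

(** The event [|X_t| > x] belongs to the conditioning sigma-field, so the squared deviation
    integrates over it like the conditional variance [v], a quadratic in [X_t] dominated for large
    [x] by its leading term. *)
Lemma process_cond_var_tail2 v A B D e :
  as_eq P (cond_var P (process_sigma X I) Y) v ->
  (forall w, v w = A * X t w ^+ 2 + B * X t w + D) -> 0 < e ->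
  exists2 x0, 0 < x0 & forall x, x0 <= x ->
    \int[P]_(w in above (X t) x) ((Y w - k * X t w) ^+ 2) <=
      (A + e) * tail2 P (X t) x.
Proof.
move=> Yv vE e0; have [x0 x00 quad] := quadratic_le_leading A B D e0.
exists x0 => // x xx0.
have X2 := XI It.
have iXX := Lfun2_integrable_sqr X2.
have iX := Lfun2_integrable X2.
have iv : P.-integrable setT (EFin \o v).
  rewrite (_ : v = fun w => A * X t w ^+ 2 + B * X t w + D); last exact/funext.
  exact: (integrableD measurableT (integrableD measurableT
    (integrableZl measurableT A iXX) (integrableZl measurableT B iX))
    (finite_measure_integrable_cst P D measurableT)).
have mA := measurable_above x (Lfun_measurable X2).
rewrite (cond_var_integral process_gens_measurable Y2 m2 _ Ym Yv iv)//; first last.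
- exact: process_sigma_above.
- exact/measurable_fun_subsigma.
rewrite /tail2 -RintegralZl//; last exact: integrable_set iXX.
apply: le_Rintegral => //.
- exact: integrable_set iv.
- exact: (integrableZl mA (A + e) (integrable_set mA iXX)).
by move=> w xw; rewrite vE quad// (le_trans xx0)// ltW.
Qed.

End process.

(** * Comparison of absolute moments and iteration of the tail bound *)

Section moments.
Context {d : measure_display} {T : measurableType d} {R : realType}.
Variable P : probability T R.
Implicit Type U : T -> R.

Lemma measurable_norm_powR U r : measurable_fun setT U ->
  measurable_fun setT (fun w => (`|U w| `^ r)%:E).
Proof.
move=> mU; apply/measurable_EFinP.
apply: (@measurableT_comp _ _ _ _ _ _ (fun x : R => x `^ r)) => //.
exact: measurableT_comp.
Qed.

Lemma fin_moment_scale U k r : 0 < k -> measurable_fun setT U ->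
  (\int[P]_w (`|(k * U w)%R| `^ r)%R%:E < +oo)%E ->
  (\int[P]_w (`|U w| `^ r)%R%:E < +oo)%E.
Proof.
move=> k0 mU kU.
have mkU : measurable_fun setT (fun w => k * U w) by exact: measurable_funM.
rewrite (_ : \int[P]_w _ =
    (k^-1 `^ r)%R%:E * \int[P]_w (`|(k * U w)%R| `^ r)%R%:E)%E.
  by rewrite lte_mul_pinfty// lee_fin powR_ge0.
rewrite -ge0_integralZl//; [|exact: measurable_norm_powR..|by rewrite lee_fin powR_ge0].
  apply: eq_integral => w _; rewrite -EFinM -powRM ?invr_ge0 ?(ltW k0)//.
  by rewrite normrM gtr0_norm// mulKf// gt_eqF.
Qed.

Lemma fin_moment_le U q r : 0 < q -> q <= r -> measurable_fun setT U ->
  (\int[P]_w (`|U w| `^ r)%R%:E < +oo)%E ->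
  (\int[P]_w (`|U w| `^ q)%R%:E < +oo)%E.
Proof.
move=> q0 qr mU rU.
apply: (@le_lt_trans _ _ (\int[P]_w (1 + (`|U w| `^ r)%R%:E))%E).
  apply: ge0_le_integral => //.
  - exact: measurable_norm_powR.
  - by apply: emeasurable_funD => //; exact: measurable_norm_powR.
  move=> w _; rewrite lee_fin.
  have [U1|U1] := leP `|U w| 1.
    rewrite -[leLHS]addr0 lerD ?powR_ge0//.
    apply: (@le_trans _ _ (1 `^ q)); last by rewrite powR1.
    by rewrite ge0_ler_powR ?nnegrE// ltW.
  by rewrite -[leLHS]add0r lerD// ler_powR// ltW.
rewrite ge0_integralD//; last exact: measurable_norm_powR.
rewrite integral_cst// lte_add_pinfty//.
by rewrite mul1e ltey_eq fin_num_measure.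
Qed.

Lemma tail2_geometric U rho x1 : 0 < x1 -> 0 <= rho ->
  (forall x, x1 <= x -> tail2 P U x <= rho * tail2 P U (x / 16)) ->
  forall n, tail2 P U (x1 * 16 ^+ n) <= tail2 P U x1 * rho ^+ n.
Proof.
move=> x10 rho0 step; elim=> [|n IH]; first by rewrite !expr0 !mulr1.
have x1n : x1 <= x1 * 16 ^+ n.+1.
  by rewrite ler_peMr ?(ltW x10)// exprn_ege1// ler1n.
apply: (le_trans (step _ x1n)).
rewrite exprSr mulrA mulfK// exprS mulrCA ler_wpM2l//.
Qed.

End moments.

Theorem theorem2p5 (R : realType) (d : measure_display) (T : measurableType d)
    (P : probability T R) (X : R -> T -> R) (eta theta sigma tau : R)
    (X_sep : separable_process P X)
    (X_L2 : forall t : R, 0 < t -> X t \in Lfun P 2%:E)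
    (X_mean : forall t : R, 0 < t -> ('E_P[X t] = 0)%E)
    (X_cov : forall t s : R, 0 < t -> 0 < s ->
       ('E_P[fun w => (X t w * X s w)%R] = (Num.min t s)%:E)%E)
    (sigma_ge0 : 0 <= sigma) (tau_ge0 : 0 <= tau)
    (X_cond : forall s t u : R, 0 < s -> s < t -> t < u ->
       [/\ as_eq P (cond_exp P (sigma_ge X u) (X t))
             (fun w => t / u * X u w),
           as_eq P (cond_exp P (sigma_le X s) (X t)) (X s),
           as_eq P (cond_var P (sigma_le X s) (X t))
             (fun w => (t - s) / (1 + sigma * s) *
                       (sigma * X s w ^+ 2 + eta * X s w + 1)) &
           as_eq P (cond_var P (sigma_ge X u) (X t))
             (fun w => t * (u - t) / (u + tau) *
                       (tau * (X u w ^+ 2 / u ^+ 2) +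
                        theta * (X u w / u) + 1))]) :
  (forall r : R, 2 < r -> sigma * tau <= 1 / (2 : R) `^ (4 * r + 10) ->
     forall t : R, 0 < t -> ('E_P[fun w => (`|X t w| `^ r)%R] < +oo)%E) /\
  (sigma * tau = 0 ->
     forall r t : R, 0 < r -> 0 < t -> ('E_P[fun w => (`|X t w| `^ r)%R] < +oo)%E).
Proof.
have le_L2 (s t : R) : [set t | 0 < t <= s] t -> X t \in Lfun P 2%:E.
  by move=> /andP[t0 _]; exact: X_L2.
have ge_L2 (u : R) : 0 < u -> forall t, [set t | u <= t] t -> X t \in Lfun P 2%:E.
  by move=> u0 t /= ut; apply: X_L2; exact: lt_le_trans ut.
have in_le (s : R) : 0 < s -> [set t | 0 < t <= s] s.
  by move=> s0; rewrite /= s0 lexx.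
have in_ge (u : R) : [set t | u <= t] u by rewrite /=.
have forward (s t : R) : 0 < s -> s < t ->
    as_eq P (cond_exp P (sigma_le X s) (X t)) (fun w => 1 * X s w) /\
    as_eq P (cond_var P (sigma_le X s) (X t))
             (fun w => (t - s) / (1 + sigma * s) *
                       (sigma * X s w ^+ 2 + eta * X s w + 1)).
  (* The hypothesis involves three times; [t + 1] serves as an arbitrary later one, and [t / 2]
     below as an arbitrary earlier one. *)
  move=> s0 st; have t1 : t < t + 1 by rewrite ltrDl.
  have [_ + + _] := X_cond s t (t + 1) s0 st t1.
  by rewrite (_ : (fun w => 1 * _) = X s)//; apply/funext => w; rewrite mul1r.
have backward (t u : R) : 0 < t -> t < u ->
    as_eq P (cond_exp P (sigma_ge X u) (X t)) (fun w => t / u * X u w) /\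
    as_eq P (cond_var P (sigma_ge X u) (X t))
             (fun w => t * (u - t) / (u + tau) *
                       (tau * (X u w ^+ 2 / u ^+ 2) +
                        theta * (X u w / u) + 1)).
  move=> t0 tu; have t20 : 0 < t / 2 by rewrite divr_gt0.
  by have [|+ _ _ +] := X_cond (t / 2) t u t20 _ tu; first lra.
have large (r : R) : 2 < r -> sigma * tau <= 1 / (2 : R) `^ (4 * r + 10) ->
    forall t : R, 0 < t -> ('E_P[fun w => (`|X t w| `^ r)%R] < +oo)%E.
  move=> r2 st.
  pose N : R := 16 `^ r.
  have N256 : 256 <= N.
    rewrite (_ : 256 = 16 `^ 2%:R); last by rewrite powR_mulrn//; ring.
    by rewrite /N ler_powR ?ler1n// ltW.
  have NE : (2 : R) `^ (4 * r + 10) = 1024 * N.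
    rewrite powRD; last by rewrite pnatr_eq0 implybT.
    rewrite powRrM [2 `^ 4](powR_mulrn 4)// [2 `^ 10](powR_mulrn 10)//.
    have -> : 2 ^+ 4 = 16 :> R by ring.
    have -> : 2 ^+ 10 = 1024 :> R by rewrite -natrX; congr _%:R.
    exact: mulrC.
  pose e := (1024 * N)^-1.
  have e0 : 0 < e by rewrite invr_gt0; lra.
  rewrite NE div1r -/e in st.
  (* Since [N >= 256], [e = 1 / (1024 N)] is at most [1 / 512^2]. *)
  have ste : 512 * 512 * (sigma * tau) <= 1.
    have Ne : N * e = 1 / 1024 by rewrite /e; field; rewrite gt_eqF//; lra.
    by nra.
  have [s0 s0_gt0 [als bes]] := balanced_time sigma_ge0 tau_ge0 ste.
  pose al := 39 / 25 * sigma * s0; pose be := 39 / 64 * tau / s0.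
  pose t0 := 64 / 25 * s0.
  have t0_gt0 : 0 < t0 by rewrite mulr_gt0// divr_gt0.
  have st0 : s0 < t0 by rewrite /t0; lra.
  have al0 : 0 <= al by rewrite !mulr_ge0// ltW.
  have be0 : 0 <= be by rewrite !mulr_ge0// invr_ge0 ltW.
  have albe : al * be <= e.
    (* The factor [39^2 / 1600 = 1521 / 1600] is below 1. *)
    rewrite (_ : al * be = 39 ^+ 2 / 1600 * (sigma * tau)).
      by have := mulr_ge0 sigma_ge0 tau_ge0; lra.
    by rewrite /al /be; field; rewrite gt_eqF.
  have N0 : 0 < N by rewrite powR_gt0.
  have [a1 b1 Nab] := contraction_rate N0 N256 al0 als be0 bes erefl albe.
  set a := (al + e) / _ in a1 Nab; set b := (be + e) / _ in b1 Nab.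
  have a0 : 0 <= a by rewrite divr_ge0 ?addr_ge0 ?(ltW e0)// sqr_ge0.
  have b0 : 0 <= b by rewrite divr_ge0 ?addr_ge0 ?(ltW e0)// sqr_ge0.
  have [cu vu] := forward s0 t0 s0_gt0 st0.
  have [cv vv] := backward s0 t0 s0_gt0 st0.
  have X2s := X_L2 s0 s0_gt0; have X2t := X_L2 t0 t0_gt0.
  have sts : 0 < 1 + sigma * s0 by rewrite ltr_wpDr ?mulr_ge0 ?(ltW s0_gt0).
  have tt : 0 < t0 + tau by rewrite ltr_wpDr.
  have [x0 x00 HU] := process_cond_var_tail2 (@le_L2 s0) (in_le _ s0_gt0) X2t cu
    (A := (t0 - s0) / (1 + sigma * s0) * sigma)
    (B := (t0 - s0) / (1 + sigma * s0) * eta)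
    (D := (t0 - s0) / (1 + sigma * s0)) vu (fun w => ltac:(ring)) e0.
  (* The backward error is scaled by [(25/64)^2], the square of [s0 / t0], so that it contributes
     exactly [e] to the numerator of [b]. *)
  have e'0 : 0 < (25 / 64) ^+ 2 * e by rewrite mulr_gt0// exprn_gt0// divr_gt0.
  have [x0' x0'0 HV] := process_cond_var_tail2 (ge_L2 _ t0_gt0) (in_ge t0) X2s cv
    (A := s0 * (t0 - s0) / (t0 + tau) * tau / t0 ^+ 2)
    (B := s0 * (t0 - s0) / (t0 + tau) * theta / t0)
    (D := s0 * (t0 - s0) / (t0 + tau)) vv (fun w => ltac:(ring)) e'0.
  have stq : s0 / t0 = 25 / 64 by rewrite /t0; field; rewrite gt_eqF.
  rewrite stq in HV.
  pose x1 := Num.max x0 x0'.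
  have x10 : 0 < x1 by rewrite lt_max x00.
  have HU' y : x1 <= y -> \int[P]_(w in above (X s0) y) ((X t0 w - 1 * X s0 w) ^+ 2)
      <= a * (3 / 5 * 1) ^+ 2 * tail2 P (X s0) y.
    rewrite ge_max => /andP[xy _]; apply: (le_trans (HU _ xy)).
    rewrite ler_wpM2r ?tail2_ge0//.
    rewrite mulr1 /a mulfVK; last by rewrite expf_neq0.
    rewrite lerD2r mulrAC ler_pdivrMr//.
    rewrite (_ : (t0 - s0) * sigma = al); last by rewrite /t0 /al; field.
    by rewrite ler_peMr// lerDl mulr_ge0// ltW.
  have HV' y : x1 <= y ->
      \int[P]_(w in above (X t0) y) ((X s0 w - 25 / 64 * X t0 w) ^+ 2)
      <= b * (3 / 5 * (25 / 64)) ^+ 2 * tail2 P (X t0) y.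
    rewrite ge_max => /andP[_ xy]; apply: (le_trans (HV _ xy)).
    rewrite ler_wpM2r ?tail2_ge0//.
    have -> : b * (3 / 5 * (25 / 64)) ^+ 2 =
        be * (25 / 64) ^+ 2 + (25 / 64) ^+ 2 * e.
      by rewrite /b; field.
    rewrite lerD2r.
    rewrite (_ : _ / t0 ^+ 2 = be * (25 / 64) ^+ 2 * (t0 / (t0 + tau))).
      apply: ler_piMr; first exact: mulr_ge0 be0 (sqr_ge0 _).
      by rewrite ler_pdivrMr// mul1r lerDl.
    rewrite /be /t0; field.
    by rewrite !gt_eqF// ltr_wpDr ?mulr_ge0// mulr_gt0.
  clearbody a b.
  pose rho := 256 * (a * b) / ((1 - a) * (1 - b)).
  have den : 0 < (1 - a) * (1 - b) by rewrite mulr_gt0 ?subr_gt0.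
  have rho0 : 0 <= rho.
    by apply: divr_ge0 (ltW den); exact: mulr_ge0 (ler0n _ _) (mulr_ge0 a0 b0).
  (* The iteration starts at [16 x1] because a contraction step from [x] to [x / 16] uses the
     variance bounds down to level [x / 16], which must stay above [x1]. *)
  have decay n : tail2 P (X s0) (16 * x1 * 16 ^+ n) <=
      tail2 P (X s0) (16 * x1) * rho ^+ n.
    apply: tail2_geometric => // [|x x1x]; first by rewrite mulr_gt0.
    rewrite /rho mulrAC ler_pdivlMr// mulrC.
    exact: (tail2_contraction b0 b1 (ltW x10) x1x X2s X2t HU' HV').
  (* The constant 256 in [rho] cancels [16^2], so the ratio is [N a b / ((1 - a) (1 - b))]. *)
  have krho : 16 `^ (r - 2) * rho < 1.
    rewrite (_ : _ * rho = N * (a * b) / ((1 - a) * (1 - b))).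
      by rewrite ltr_pdivrMr// mul1r.
    rewrite powRB; last by rewrite pnatr_eq0 implybT.
    rewrite powR_mulrn// -/N /rho; field.
    by rewrite !gt_eqF// subr_gt0.
  have r2' := ltW r2.
  have moment_of (U : T -> R) y : 0 < y -> U \in Lfun P 2%:E ->
      (forall x, 0 <= x -> tail2 P U (y * x) <= 4 * tail2 P (X s0) x) ->
      (\int[P]_w (`|U w| `^ r)%R%:E < +oo)%E.
    move=> y0 U2 UX.
    apply: (@fin_moment_of_decay _ _ _ P U r (y * (16 * x1))
      (4 * tail2 P (X s0) (16 * x1)) rho) => // [|n].
      by rewrite !mulr_gt0.
    rewrite -mulrA (le_trans (UX _ _))// ?mulr_ge0 ?exprn_ge0 ?(ltW x10)//.
    by rewrite -[leRHS]mulrA ler_wpM2l.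
  move=> t t_gt0; rewrite unlock.
  have X2 := X_L2 _ t_gt0.
  (* For [t < s0], [X_t] is the conditional mean of [X_{s0}] given the past; for [t > s0],
     [(s0 / t) X_t] is its conditional mean given the future. *)
  have [ts|st'|->] := ltgtP t s0.
  - have [ct _] := forward _ _ t_gt0 ts.
    apply: (moment_of (X t) 2) => // x xge0.
    have := process_tail2_transfer (@le_L2 t) (in_le _ t_gt0) X2s ct xge0.
    by rewrite (_ : (fun w => 1 * _) = X t)//; apply/funext => w; rewrite mul1r.
  - have [ct _] := backward _ _ s0_gt0 st'.
    apply: (@fin_moment_scale _ _ _ P (X t) (s0 / t)).
    + by rewrite divr_gt0.
    + exact: Lfun_measurable X2.
    apply: (moment_of _ 2) => //; first exact: Lfun2_scale.
    move=> x xge0.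
    exact: (process_tail2_transfer (ge_L2 _ t_gt0) (in_ge t) X2s ct xge0).
  - apply: (moment_of (X s0) 1) => // x _; rewrite mul1r.
    by rewrite ler_peMl ?tail2_ge0// ler1n.
split=> // st0 r t r0 t_gt0.
(* The first part requires an exponent above 2, so it is applied to the maximum of [r] and 3; the
   lower moment then follows from [|U|^q <= 1 + |U|^r]. *)
have r3 : 2 < Num.max r 3 by rewrite lt_max; apply/orP; right; lra.
have := large _ r3 _ t t_gt0; rewrite st0 => /(_ (divr_ge0 ler01 (powR_ge0 _ _))).
rewrite unlock; apply: fin_moment_le => //.
  by rewrite le_max lexx.
exact: Lfun_measurable (X_L2 _ t_gt0).
Qed.
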